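(* Let $k\ge1$ be an integer. If $G$ is a $\delta$-regular finite simple graph of order $n$ with complement $\overline{G}$, then $$d_R^k(G)+d_R^k(\overline{G})\le \max\{4k-2,\ n+2k-1,\ n+3k-2-\delta,\ 3k+\delta-1\}.$$
   Context: Let $k\ge1$ be an integer. A Roman $k$-dominating function (RkDF) on a graph $G$ is a map $f:V(G)\to\{0,1,2\}$ such that every vertex $v$ with $f(v)=0$ has at least $k$ neighbors $u$ with $f(u)=2$. A set $\{f_1,\ldots,f_d\}$ of pairwise distinct RkDFs on $G$ with $\sum_{i=1}^d f_i(v)\le 2k$ for every $v\in V(G)$ is a Roman $(k,k)$-dominating family on $G$; the maximum number of functions in such a family is the Roman $(k,k)$-domatic number $d_R^k(G)$. *)

(* Defs.v *)
From mathcomp Require Import all_boot.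

Set Implicit Arguments.
Unset Strict Implicit.
Unset Printing Implicit Defensive.

(* A finite simple graph is a symmetric irreflexive relation e on a finType. *)
Section RomanDomatic.

Variable T : finType.

Implicit Type e : rel T.

Definition simple_graph e : Prop := symmetric e /\ irreflexive e.

Definition compl_graph e : rel T := [rel x y | (x != y) && ~~ e x y].

Definition neighbors e (v : T) : {set T} := [set u | e v u].

Definition regular_graph e (delta : nat) : Prop :=
  forall v, #|neighbors e v| = delta.

Definition RkDF (k : nat) e (f : {ffun T -> 'I_3}) : bool :=
  [forall v, (f v == 0 :> nat) ==>
             (k <= #|[set u in neighbors e v | f u == 2 :> nat]|)].

(* The functions of a family are pairwise distinct since F is a set. *)
Definition Rkk_family (k : nat) e (F : {set {ffun T -> 'I_3}}) : bool :=
  [forall f in F, RkDF k e f] &&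
  [forall v, \sum_(f in F) (f v : nat) <= 2 * k].

Definition Rkk_domatic (k : nat) e : nat :=
  \max_(F : {set {ffun T -> 'I_3}} | Rkk_family k e F) #|F|.

End RomanDomatic.

(* Main.v *)
Require Import Defs.
From mathcomp Require Import all_boot.
From mathcomp Require Import zify.

Set Implicit Arguments.
Unset Strict Implicit.
Unset Printing Implicit Defensive.

(** On a [delta]-regular graph, [d_R^k <= max (2k-1, k+delta)]; the theorem
    adds these bounds for the graph and for its complement, which is
    [(n-1-delta)]-regular.

    If [delta < k], no vertex can be assigned 0, so every function is at least
    1 everywhere and a family has at most [2k] members; equality would force
    all of them to be constantly 1.  If [k <= delta], counting the edges between
    the vertices of value 0 and those of value 2 gives [k n0 <= delta n2], hence
    every function has weight at least [2kn/(delta+k)], whereas the weights of a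
    family sum to at most [2kn]. *)

Section RegularBound.

Variables (T : finType) (k : nat) (e : rel T) (delta : nat).
Hypothesis hreg : regular_graph e delta.

Lemma RkDF_zero_le_two (f : {ffun T -> 'I_3}) :
  symmetric e -> RkDF k e f ->
  k * #|[set v | f v == 0 :> nat]| <= delta * #|[set v | f v == 2 :> nat]|.
Proof.
move=> esym /forallP hf.
pose cross := \sum_(v in [set v | f v == 0 :> nat])
  \sum_(u in [set u | f u == 2 :> nat]) (e v u : nat).
apply: (@leq_trans cross).
  rewrite mulnC -sum_nat_const; apply: leq_sum => v; rewrite inE => fv0.
  apply: leq_trans (implyP (hf v) fv0) _.
  rewrite -sum1_card big_mkcond [leqRHS]big_mkcond /=.
  by apply: leq_sum => u _; rewrite !inE; case: (e v u); case: (_ == 2).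
rewrite /cross exchange_big /= mulnC -sum_nat_const.
apply: leq_sum => u _; rewrite -(hreg u) -sum1_card big_mkcond.
rewrite [leqRHS]big_mkcond /=; apply: leq_sum => v _.
by rewrite !inE esym; case: (e u v); case: (_ == 0).
Qed.

Lemma RkDF_weight_ge (f : {ffun T -> 'I_3}) :
  symmetric e -> k <= delta -> RkDF k e f ->
  2 * k * #|T| <= (delta + k) * \sum_v (f v : nat).
Proof.
move=> esym kd /(RkDF_zero_le_two esym).
set n0 := #|_|; set n2 := #|_|; pose n1 := #|[set v | f v == 1 :> nat]|.
have cardE (p : pred T) : #|[set v | p v]| = \sum_v (p v : nat).
  by rewrite -sum1dep_card big_mkcond; apply: eq_bigr => v _; case: (p v).
have hcount : #|T| = n0 + n1 + n2.
  rewrite /n0 /n1 /n2 !cardE -sum1_card -!big_split.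
  by apply: eq_bigr => v _; case: (f v) => [[|[|[|m]]]].
have hweight : \sum_v (f v : nat) = n1 + 2 * n2.
  rewrite /n1 /n2 !cardE big_distrr -big_split.
  by apply: eq_bigr => v _; case: (f v) => [[|[|[|m]]]].
rewrite hcount hweight => h02.
have : k * n1 <= delta * n1 by rewrite leq_mul2r kd orbT.
(* The right side minus the left is [(delta - k) * n1 + 2 * (delta * n2 - k * n0)]. *)
nia.
Qed.

Lemma RkDF_pos (f : {ffun T -> 'I_3}) v :
  delta < k -> RkDF k e f -> 0 < f v.
Proof.
move=> dk /forallP/(_ v)/implyP hf; rewrite lt0n; apply/negP => /hf.
apply/negP; rewrite -ltnNge; apply: leq_ltn_trans dk.
by rewrite -(hreg v); apply/subset_leq_card/subsetP => u; rewrite !inE => /andP[].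
Qed.

Lemma Rkk_domatic_regular :
  1 <= k -> symmetric e -> Rkk_domatic k e <= maxn (2 * k - 1) (k + delta).
Proof.
move=> hk esym; apply/bigmax_leqP => F /andP[/'forall_implyP hF /forallP hsum].
have [dk|kd] := ltnP delta k.
  have fpos f v : f \in F -> 0 < f v by move=> /hF; apply: RkDF_pos.
  have [small|F_ge] := ltnP #|F| (2 * k); first by lia.
  suff : #|F| <= 1 by lia.
  apply/card_le1_eqP => f g fF gF; apply/ffunP => v.
  have all1 h : h \in F -> h v = 1 :> nat.
    move=> hh; have := hsum v; rewrite (bigD1 h) //=.
    (* The other members already use at least [2 * k - 1] of the budget [2 * k] at [v], leaving at
       most 1 for [h v]. *)
    have : #|F|.-1 <= \sum_(i in F | i != h) (i v : nat).
      rewrite (cardD1 h) hh /= -sum1_card.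
      rewrite (eq_bigl (fun i => (i \in F) && (i != h))) => [|i].
        by apply: leq_sum => i /andP[/fpos].
      by rewrite !inE andbC.
    move: F_ge (fpos h v hh).
    by move: #|F| (\sum_(i in F | _) _) (h v : nat) => c s x; lia.
  by apply: val_inj; rewrite /= !all1.
(* The empty graph is set apart because the main case cancels [2 * k * #|T|]. *)
have [T0|Tpos] := posnP #|T|.
  suff : #|F| <= 1 by lia.
  by apply/card_le1_eqP => f g _ _; apply/ffunP => v; have := fintype0 v T0.
suff : #|F| * (2 * k * #|T|) <= (k + delta) * (2 * k * #|T|).
  by rewrite leq_pmul2r; [rewrite leq_max orbC => -> | lia].
apply: (@leq_trans (\sum_(f in F) (delta + k) * \sum_v (f v : nat))).
  by rewrite -sum_nat_const; apply: leq_sum => f /hF; apply: RkDF_weight_ge.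
rewrite -big_distrr exchange_big /= addnC leq_mul2l; apply/orP; right.
by rewrite mulnC -sum_nat_const; apply: leq_sum => v _; apply: hsum.
Qed.

End RegularBound.

Lemma compl_graph_sym (T : finType) (e : rel T) :
  symmetric e -> symmetric (compl_graph e).
Proof. by move=> esym x y; rewrite /compl_graph /= eq_sym esym. Qed.

Lemma card_neighbors_compl (T : finType) (e : rel T) v :
  irreflexive e ->
  #|neighbors e v| + #|neighbors (compl_graph e) v| + 1 = #|T|.
Proof.
move=> eirr; rewrite -(cardsC (neighbors e v)) -addnA; congr (_ + _).
rewrite (cardsD1 v (~: _)) !inE eirr addnC; congr (_ + _).
by apply: eq_card => u; rewrite !inE eq_sym.
Qed.

(* The subtractions are on nat; since 1 <= k, and delta < #|T| when T is
   nonempty, none of them truncates on a nonempty graph. *)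
Theorem theorem8 (k : nat) (hk : 1 <= k) (T : finType) (e : rel T)
    (n delta : nat) (he : simple_graph e) (hn : #|T| = n)
    (hreg : regular_graph e delta) :
  Rkk_domatic k e + Rkk_domatic k (compl_graph e) <=
    maxn (4 * k - 2)
      (maxn (n + 2 * k - 1)
        (maxn (n + 3 * k - 2 - delta) (3 * k + delta - 1))).
Proof.
case: he => esym eirr.
have [v0 _|T0] := pickP T.
  have hv v : delta + #|neighbors (compl_graph e) v| + 1 = n.
    by rewrite -(hreg v) card_neighbors_compl.
  have hregC : regular_graph (compl_graph e) (n - 1 - delta).
    by move=> v; have := hv v; lia.
  (* Each bound is a maximum of two terms; their four pairwise sums are the four terms of the
     goal. *)
  have := Rkk_domatic_regular hregC hk (compl_graph_sym esym).
  have := Rkk_domatic_regular hreg hk esym; have := hv v0; lia.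
(* Without vertices [delta] is arbitrary; taking degree 0 bounds each number by [2 * k - 1], giving
   [4 * k - 2]. *)
have reg0 (e' : rel T) : regular_graph e' 0 by move=> v; have := T0 v.
have := Rkk_domatic_regular (reg0 (compl_graph e)) hk (compl_graph_sym esym).
have := Rkk_domatic_regular (reg0 e) hk esym; lia.
Qed.
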